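(* Let $\mathcal{H}=\mathcal{H}(\Omega)$ be a functional (reproducing kernel) Hilbert space on a nonempty set $\Omega$, let $t\in[0,1]$ and let $A,B,C,D\in\mathcal{B}(\mathcal{H})$. Then $$\left\|\begin{pmatrix}A&B\\C&D\end{pmatrix}\right\|_{t-ber}\le\left\|\begin{pmatrix}\|A\|_{t-ber}&t\|B\|_{ber}+(1-t)\|C\|_{ber}\\t\|C\|_{ber}+(1-t)\|B\|_{ber}&\|D\|_{t-ber}\end{pmatrix}\right\|,$$ where the operator matrix on the left acts on $\mathcal{H}\oplus\mathcal{H}$ and the norm on the right is the operator norm of a $2\times2$ scalar matrix acting on $\mathbb{C}^2$ with its Euclidean norm.
   Context: A functional (reproducing kernel) Hilbert space $\mathcal{H}=\mathcal{H}(\Omega)$ is a Hilbert space of complex-valued functions on a nonempty set $\Omega$ such that for every $\lambda\in\Omega$ the evaluation $f\mapsto f(\lambda)$ is a continuous linear functional; $k_\lambda\in\mathcal{H}$ is the unique element with $f(\lambda)=\langle f,k_\lambda\rangle$ for all $f\in\mathcal{H}$. It is assumed that $k_\lambda\neq0$ for all $\lambda\in\Omega$, and $\hat{k}_\lambda=k_\lambda/\|k_\lambda\|$ is the normalized reproducing kernel. $\mathcal{B}(\mathcal{H})$ is the algebra of bounded linear operators on $\mathcal{H}$. For $A\in\mathcal{B}(\mathcal{H})$ and $t\in[0,1]$, $$\|A\|_{t-ber}=\sup_{\lambda,\mu\in\Omega}\left\{t|\langle A\hat{k}_\lambda,\hat{k}_\mu\rangle|+(1-t)|\langle A^*\hat{k}_\lambda,\hat{k}_\mu\rangle|\right\},\qquad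 \|A\|_{ber}=\sup_{\lambda,\mu\in\Omega}|\langle A\hat{k}_\lambda,\hat{k}_\mu\rangle|.$$ For operators on $\mathcal{H}\oplus\mathcal{H}$ the index set is $\Omega\times\Omega$, the kernel at $(\lambda_1,\lambda_2)$ is the vector $(k_{\lambda_1},k_{\lambda_2})\in\mathcal{H}\oplus\mathcal{H}$, and its normalization is $\hat{k}_{(\lambda_1,\lambda_2)}=(k_{\lambda_1},k_{\lambda_2})/\sqrt{\|k_{\lambda_1}\|^2+\|k_{\lambda_2}\|^2}$; thus for $T\in\mathcal{B}(\mathcal{H}\oplus\mathcal{H})$, $$\|T\|_{t-ber}=\sup\left\{t|\langle T\hat{k}_{(\lambda_1,\lambda_2)},\hat{k}_{(\mu_1,\mu_2)}\rangle|+(1-t)|\langle T^*\hat{k}_{(\lambda_1,\lambda_2)},\hat{k}_{(\mu_1,\mu_2)}\rangle|:(\lambda_1,\lambda_2),(\mu_1,\mu_2)\in\Omega\times\Omega\right\}.$$ *)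

(* Defs.v *)
From HB Require Import structures.
From mathcomp Require Import all_boot all_order all_algebra.
From mathcomp Require Import all_classical all_reals all_analysis.
From mathcomp Require Import complex.
From mathcomp Require Import ring lra.
Set Implicit Arguments.
Unset Strict Implicit.
Unset Printing Implicit Defensive.
Import Order.TTheory GRing.Theory Num.Theory.
Import numFieldNormedType.Exports.
Local Open Scope classical_set_scope.
Local Open Scope ring_scope.
Local Open Scope complex_scope.

(* A Hilbert space of functions Omega -> C: rk_eval, being linear and injective,
   identifies each vector with a function. The inner product is linear in its
   first argument; R[i]^o is C with its usual topology. *)
Structure rkhs (R : realType) (Omega : Type) := RKHS {
  rk_space :> completeNormedModType R[i];
  rk_dot : {dot rk_space for Num.conj};
  rk_normE : forall f : rk_space, `|f| ^+ 2 = rk_dot f f;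
  rk_eval : {linear rk_space -> (Omega -> R[i])};
  rk_eval_inj : injective rk_eval;
  rk_eval_continuous : forall l : Omega,
    continuous (fun f : rk_space => rk_eval f l : R[i]^o)
}.

Arguments rk_eval_continuous {R Omega} H l : rename.

(* The unique y with phi x = <x, y> for all x, or 0 if there is none; the lemma
   riesz below gives existence for bounded phi on a Hilbert space. *)
Definition representer (C : pzRingType) (U : lmodType C) (dot : U -> U -> C)
    (phi : U -> C) : U :=
  xget 0 [set y | forall x, phi x = dot x y].

(* The operator S with <T x, y> = <x, S y>; it exists for bounded T by riesz. *)
Definition adjoint (C : pzRingType) (U : lmodType C) (dot : U -> U -> C)
    (T : U -> U) (y : U) : U :=
  representer dot (fun x => dot (T x) y).

Section riesz.
Variables (R : realType) (Omega : Type) (H : rkhs R Omega).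
Local Notation "''[' u , v ]" := (rk_dot H u v).
Implicit Types x y u v : H.

Let q x : R := complex.Re '[x, x].

Let dotC u v : '[u, v] = ('[v, u])^*.
Proof. by rewrite hermC expr0 mul1r. Qed.

Let dotZl a u v : '[a *: u, v] = a * '[u, v].
Proof. by rewrite linearZl_LR. Qed.

Let dotZr a u v : '[u, a *: v] = a^* * '[u, v].
Proof. by rewrite dotC dotZl rmorphM /= -dotC. Qed.

Let dotNr u v : '[u, - v] = - '[u, v].
Proof. by rewrite linearNr. Qed.

Let dotBl u v w : '[u - v, w] = '[u, w] - '[v, w].
Proof. by rewrite linearBl. Qed.

Let qE x : '[x, x] = (q x)%:C.
Proof.
have : 0 <= '[x, x] by rewrite -rk_normE exprn_ge0.
rewrite /q; case: ('[x, x]) => a b; by rewrite lecE /= => /andP[/eqP -> _].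
Qed.

Let q_ge0 x : 0 <= q x.
Proof. by rewrite -ler0c -qE -rk_normE exprn_ge0. Qed.

Let normE x : `|x| = (Num.sqrt (q x))%:C.
Proof.
apply/eqP; rewrite -(@eqrXn2 _ 2)// ?ler0c ?sqrtr_ge0//.
by rewrite rk_normE qE -rmorphXn /= sqr_sqrtr.
Qed.

Let qD x y : q (x + y) = q x + q y + 2 * complex.Re '[x, y].
Proof.
rewrite /q linearDl /= !linearDr /= !raddfD /= (dotC y x).
by case: ('[x, y]) => a b /=; ring.
Qed.

Let qZ a x : q (a *: x) = complex.Re (a * a^*) * q x.
Proof.
rewrite /q dotZl dotZr qE mulrA.
by case: a => a b /=; ring.
Qed.

Let qN x : q (- x) = q x.
Proof. by rewrite -scaleN1r qZ /=; ring. Qed.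

Let qB x y : q (x - y) = 2 * q x + 2 * q y - q (x + y).
Proof. by rewrite !qD qN dotNr raddfN /=; ring. Qed.

Lemma riesz (phi : {linear H -> R[i]^o}) :
  continuous phi -> exists y, forall x, phi x = '[x, y].
Proof.
move=> phic.
have phiZ a x : phi (a *: x) = a * phi x by rewrite linearZ.
have phiD x y : phi (x + y) = phi x + phi y by rewrite linearD.
have phiB x y : phi (x - y) = phi x - phi y by rewrite linearB.
have [phi0|/existsNP[x0 /eqP phix0]] := pselect (forall x, phi x = 0).
  by exists 0 => x; rewrite phi0 linear0r.
pose S := [set q x | x in [set x | phi x = 1]].
have S0 : S !=set0.
  exists (q ((phi x0)^-1 *: x0)), ((phi x0)^-1 *: x0) => //=.
  by rewrite phiZ mulVf.
have Slb : has_lbound S by exists 0 => _ [x _ <-].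
pose d := inf S.
have dle x : phi x = 1 -> d <= q x.
  by move=> px; apply: ge_inf => //; exists x.
have d_ge0 : 0 <= d by apply: lb_le_inf => // _ [x _ <-].
have xP n : exists x, phi x = 1 /\ q x < d + n.+1%:R^-1.
  have [|_ [x px <-] lt] := @inf_adherent R S n.+1%:R^-1 _ (conj S0 Slb).
    by rewrite invr_gt0.
  by exists x.
have [u uP] := choice xP.
have phiu n : phi (u n) = 1 := (uP n).1.
have qu n : q (u n) < d + n.+1%:R^-1 := (uP n).2.
have quB m n : (n <= m)%N -> q (u n - u m) <= 4 * n.+1%:R^-1.
  move=> nm.
  have le_inv : m.+1%:R^-1 <= n.+1%:R^-1 :> R.
    by rewrite lef_pV2 ?posrE// ler_nat.
  have := dle (2^-1 *: (u n + u m)).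
  rewrite phiZ phiD !phiu -[1 + 1]/(2%:R) mulVf ?pnatr_eq0//.
  move=> /(_ erefl); rewrite qZ.
  have -> : complex.Re (2^-1 * (2^-1 : R[i])^*) = 4^-1.
    by rewrite fmorphV rmorph_nat -invfM -natrM -(rmorph_nat (real_complex R)) -fmorphV.
  rewrite qB; move: le_inv; have := qu n; have := qu m.
  move: (n.+1%:R^-1) (m.+1%:R^-1) => a b; lra.
have inv_small (e : R) : 0 < e -> exists n : nat, n.+1%:R^-1 < e.
  move=> e0; exists (Num.truncn e^-1).
  rewrite invf_plt ?posrE//.
  exact: truncnS_gt.
have ltN (e : R[i]) (v : H) : 0 < e -> q v < complex.Re e ^+ 2 -> `|v| < e.
  case: e => e f; rewrite ltcE /= => /andP[/eqP -> e0] lt.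
  rewrite normE ltcR -(@ltr_pXn2r _ 2) ?nnegrE ?sqrtr_ge0 ?(ltW e0)//.
  by rewrite sqr_sqrtr.
have uc : cvg (u @ \oo).
  apply/cauchy_cvgP; apply: cauchy_exP => e e0.
  have e0' : 0 < complex.Re e.
    by move: e0; rewrite ltcE => /andP[].
  have [|n nlt] := inv_small (4^-1 * complex.Re e ^+ 2).
    by rewrite mulr_gt0 ?exprn_gt0.
  exists (u n); exists n => // m /= nm.
  rewrite -ball_normE /=; apply: ltN => //.
  apply: le_lt_trans (quB _ _ nm) _.
  by move: nlt; move: (n.+1%:R^-1) (complex.Re e ^+ 2) => a b; lra.
pose z := lim (u @ \oo).
have uz : u @ \oo --> z by [].
have phiz : phi z = 1.
  have : phi \o u @ \oo --> phi z by apply: continuous_cvg => //; exact: phic.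
  have -> : phi \o u = fun=> 1 by apply/funext => n /=.
  by move=> /(cvg_lim (@norm_hausdorff _ _)); rewrite lim_cst.
have qz : q z <= d.
  apply/ler_addgt0Pr => e e0.
  have d1 : 0 < d + 1 by lra.
  pose s := e / 4 / (d + 1).
  have s0 : 0 < s by rewrite !divr_gt0.
  have sd : s * (d + 1) = e / 4 by rewrite /s divfK ?gt_eqF.
  pose r := e / 4 / (1 + s^-1).
  have s1 : 0 < 1 + s^-1 by rewrite addr_gt0 ?invr_gt0.
  have r0 : 0 < r by rewrite !divr_gt0.
  have rs : (1 + s^-1) * r = e / 4 by rewrite /r mulrC divfK ?gt_eqF.
  have [N Nlt] : exists n : nat, n.+1%:R^-1 < Num.min 1 (e / 4).
    by apply: inv_small; rewrite lt_min ltr01 divr_gt0.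
  have [M _ uM] : \forall n \near \oo, `|z - u n| < (Num.sqrt r)%:C.
    by move/cvgrPdist_lt : uz; apply; rewrite ltcR sqrtr_gt0.
  pose n := maxn N M.
  have : `|z - u n| < (Num.sqrt r)%:C by apply: uM; rewrite /= leq_maxr.
  rewrite normE ltcR ltr_sqrt// => qzu.
  have {}Nlt : n.+1%:R^-1 < Num.min 1 (e / 4).
    apply: le_lt_trans Nlt.
    by rewrite lef_pV2 ?posrE// ler_nat ltnS leq_maxl.
  move: Nlt; rewrite lt_min => /andP[n1 ne].
  have {}qu := qu n.
  have -> : z = u n + (z - u n) by rewrite addrC subrK.
  rewrite qD.
  move: (z - u n) qzu => y qzu.
  have : 0 <= s^-1 * q (s%:C *: u n - y) by rewrite mulr_ge0 ?invr_ge0 ?(ltW s0).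
  rewrite qD qN qZ dotNr dotZl.
  have -> : complex.Re (s%:C * (s%:C)^*) = s ^+ 2 by rewrite /=; ring.
  have -> : complex.Re (- (s%:C * '[u n, y])) = - (s * complex.Re '[u n, y]).
    by case: ('[u n, y]) => a b /=; ring.
  have -> : s^-1 * (s ^+ 2 * q (u n) + q y + 2 * - (s * complex.Re '[u n, y]))
            = s * q (u n) + s^-1 * q y - 2 * complex.Re '[u n, y].
    by field; rewrite gt_eqF.
  have : s * q (u n) <= e / 4.
    by rewrite -sd ler_wpM2l ?(ltW s0)//; apply: le_trans (ltW qu) _; rewrite lerD2l ltW.
  have : (1 + s^-1) * q y <= e / 4 by rewrite -rs ler_wpM2l ?(ltW s1) ?(ltW qzu).
  move: qu ne; move: (n.+1%:R^-1) (s^-1) => a b; lra.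
have orth v : phi v = 0 -> '[v, z] = 0.
  move=> phiv; apply/eqP; apply: contraT => c0.
  set c := '[v, z] in c0 *; pose s : R := (q v + 1)^-1.
  have q1 : 0 < q v + 1 by rewrite ltr_wpDl.
  have s0 : 0 < s by rewrite invr_gt0.
  have sq : s * q v = 1 - s by rewrite /s; field; rewrite gt_eqF.
  have := dle (z - (s%:C * c^*) *: v).
  rewrite phiB phiZ phiv mulr0 subr0 => /(_ phiz).
  rewrite qD qN qZ dotNr dotZr dotC -/c.
  pose w := complex.Re (c * c^*).
  have w0 : 0 < w.
    have : 0 < c * c^* by rewrite mul_conjC_gt0.
    by rewrite ltcE => /andP[].
  have -> : complex.Re (- ((s%:C * c^*)^* * c^*)) = - (s * w).
    by rewrite /w; case: (c) => a b /=; ring.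
  have -> : complex.Re (s%:C * c^* * (s%:C * c^*)^*) = s * s * w.
    by rewrite /w; case: (c) => a b /=; ring.
  have -> : s * s * w * q v = (s * w) * (1 - s) by rewrite -sq; ring.
  have sw0 : 0 < s * w by rewrite mulr_gt0.
  have ssw0 : 0 < s * w * s by rewrite mulr_gt0.
  nra.
have qz0 : q z != 0.
  apply: contra_eq_neq phiz => qz0.
  have -> : z = 0 by apply/eqP; rewrite -normr_eq0 normE qz0 sqrtr0.
  by rewrite linear0 eq_sym oner_eq0.
exists ((q z)^-1%:C *: z) => x.
have : '[x - phi x *: z, z] = 0.
  by apply: orth; rewrite phiB phiZ phiz mulr1 subrr.
rewrite dotBl dotZl dotZr qE => /eqP; rewrite subr_eq0 => /eqP ->.
transitivity ((q z)^-1%:C * (phi x * (q z)%:C)).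
  by rewrite mulrCA -rmorphM /= mulVf// mulr1.
by congr (_ * _); exact/esym/conjc_real.
Qed.

Let cauchy_schwarz x y : `|'[x, y]| <= `|x| * `|y|.
Proof.
rewrite -(@ler_pXn2r _ 2) ?nnegrE ?mulr_ge0// exprMn !rk_normE !qE.
rewrite sqr_normc -rmorphM /=.
have -> : '[x, y] * ('[x, y])^* = (complex.Re ('[x, y] * ('[x, y])^*))%:C.
  by case: ('[x, y]) => a b; apply/eqP; rewrite eq_complex /= eqxx /=; apply/eqP; ring.
rewrite lecR.
have [->|y0] := eqVneq y 0; first by rewrite linear0r /= !mul0r subr0 mulr_ge0.
have qy0 : 0 < q y.
  rewrite lt_neqAle q_ge0 andbT eq_sym; apply: contra_neq y0 => qy0.
  by apply/eqP; rewrite -normr_eq0 normE qy0 sqrtr0.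
have : 0 <= q y * q (x - ((q y)^-1%:C * '[x, y]) *: y) by rewrite mulr_ge0.
rewrite qD qN qZ dotNr dotZr.
case: ('[x, y]) => a b /= h.
rewrite -subr_ge0; move: h; congr (_ <= _).
by field; rewrite gt_eqF.
Qed.

Lemma rk_dot_continuous (y : H) : continuous (fun x : H => '[x, y] : R[i]^o).
Proof.
pose f x : R[i]^o := '[x, y].
have lf : linear f by move=> a u v; rewrite /f linearDl /= dotZl.
pose L := HB.pack_for {linear H -> R[i]^o} f
  (GRing.isLinear.Build _ _ _ _ f lf).
apply: (@bounded_linear_continuous _ _ _ L).
apply/linear_boundedP; near=> r => x /=; rewrite /f.
apply: le_trans (cauchy_schwarz x y) _.
by rewrite mulrC ler_wpM2r//; near: r; apply: nbhs_pinfty_ge; exact: normr_real.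
Unshelve. all: by end_near. Qed.

End riesz.

Section rkhs_operators.
Variables (R : realType) (Omega : Type) (H : rkhs R Omega).

Definition rk_ker (l : Omega) : H :=
  representer (rk_dot H) (fun f => rk_eval H f l).

Lemma rk_kerE (f : H) l : rk_eval H f l = rk_dot H f (rk_ker l).
Proof.
pose e (f : H) : R[i]^o := rk_eval H f l.
have le : linear e by move=> a u v; rewrite /e linearP.
pose L := HB.pack_for {linear H -> R[i]^o} e
  (GRing.isLinear.Build _ _ _ _ e le).
have [y Ly] := @riesz _ _ _ L (rk_eval_continuous H l).
by move: f; apply: (@xgetPex _ 0 [set y | forall x, e x = rk_dot H x y]); exists y.
Qed.

Lemma adjointP (A : {linear H -> H}) : continuous A -> forall x y : H,
  rk_dot H (A x) y = rk_dot H x (adjoint (rk_dot H) A y).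
Proof.
move=> Ac x y; pose e x : R[i]^o := rk_dot H (A x) y.
have le : linear e by move=> a u v; rewrite /e linearP linearDl /= linearZl_LR.
pose L := HB.pack_for {linear H -> R[i]^o} e
  (GRing.isLinear.Build _ _ _ _ e le).
have Lc : continuous L.
  by move=> z; apply: (@continuous_comp _ _ _ A (fun x => rk_dot H x y : R[i]^o));
    [exact: Ac|exact: rk_dot_continuous].
have [z Lz] := riesz Lc.
by move: x; apply: (@xgetPex _ 0 [set z | forall x, e x = rk_dot H x z]); exists z.
Qed.

(* The library norm on a product is the max norm, so the Euclidean structure of
   the Hilbert direct sum is carried by this inner product. *)
Definition dsum_dot (x y : H * H) : R[i] :=
  rk_dot H x.1 y.1 + rk_dot H x.2 y.2.

Definition opmx2 (A B C D : H -> H) (x : H * H) : H * H :=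
  (A x.1 + B x.2, C x.1 + D x.2).

Lemma dsum_adjointP (A B C D : {linear H -> H}) :
  continuous A -> continuous B -> continuous C -> continuous D ->
  forall x y : H * H, dsum_dot (opmx2 A B C D x) y =
    dsum_dot x (adjoint dsum_dot (opmx2 A B C D) y).
Proof.
move=> Ac Bc Cc Dc x y; move: x.
apply: (@xgetPex _ 0 [set z | forall x, dsum_dot (opmx2 A B C D x) y = dsum_dot x z]).
pose adj := adjoint (rk_dot H).
exists (adj A y.1 + adj C y.2, adj B y.1 + adj D y.2) => x.
rewrite /dsum_dot /opmx2 /= !linearDl !linearDr /= !adjointP//.
by rewrite addrACA.
Qed.

Definition rk_nker (l : Omega) : H := `|rk_ker l|^-1 *: rk_ker l.

Definition dsum_nker (l : Omega * Omega) : H * H :=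
  (sqrtC (`|rk_ker l.1| ^+ 2 + `|rk_ker l.2| ^+ 2))^-1 *:
    (rk_ker l.1, rk_ker l.2).

End rkhs_operators.

Section berezin.
Variables (R : realType) (I : Type) (U : lmodType R[i]).
Variables (dot : U -> U -> R[i]) (nker : I -> U).

(* Normc.normc is the complex modulus with values in R, whereas `|_| on R[i] is
   R[i]-valued. *)
Definition tber_norm (t : R) (T : U -> U) : R :=
  sup [set t * Normc.normc (dot (T (nker p.1)) (nker p.2)) +
           (1 - t) * Normc.normc (dot (adjoint dot T (nker p.1)) (nker p.2))
      | p in [set: I * I]].

Definition ber_norm (T : U -> U) : R :=
  sup [set Normc.normc (dot (T (nker p.1)) (nker p.2)) | p in [set: I * I]].

End berezin.

Section rkhs_berezin.
Variables (R : realType) (Omega : Type) (H : rkhs R Omega).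

Definition rk_tber (t : R) (A : H -> H) : R :=
  tber_norm (rk_dot H) (@rk_nker R Omega H) t A.

Definition rk_ber (A : H -> H) : R :=
  ber_norm (rk_dot H) (@rk_nker R Omega H) A.

Definition dsum_tber (t : R) (T : H * H -> H * H) : R :=
  tber_norm (@dsum_dot R Omega H) (@dsum_nker R Omega H) t T.

End rkhs_berezin.

Definition l2norm (R : realType) (n : nat) (x : 'cV[R[i]]_n) : R :=
  Num.sqrt (\sum_(i < n) Normc.normc (x i 0) ^+ 2).

Definition mx_opnorm (R : realType) (n : nat) (M : 'M[R[i]]_n) : R :=
  sup [set l2norm (M *m x) | x in [set x : 'cV[R[i]]_n | l2norm x <= 1]].

Definition mx22 (T : Type) (a b c d : T) : 'M[T]_2 :=
  \matrix_(i < 2, j < 2)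
    if i == 0 then (if j == 0 then a else b) else (if j == 0 then c else d).

(* Main.v *)
Require Import Defs.
From HB Require Import structures.
From mathcomp Require Import all_boot all_order all_algebra.
From mathcomp Require Import all_classical all_reals all_analysis.
From mathcomp Require Import complex.
From mathcomp Require Import ring lra.
Set Implicit Arguments.
Unset Strict Implicit.
Unset Printing Implicit Defensive.
Import Order.TTheory GRing.Theory Num.Theory.
Import numFieldNormedType.Exports.
Local Open Scope classical_set_scope.
Local Open Scope ring_scope.
Local Open Scope complex_scope.

(** Write T for the operator matrix. A normalized kernel of the direct sum is
    (u1 k_(l1), u2 k_(l2)), where k_(l1), k_(l2) are normalized kernels of H and
    (u1, u2) is a unit vector of R^2 with nonnegative entries ([dsum_nkerE]); let
    (v1, v2) be the weights of a second one, at (m1, m2). By sesquilinearity and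
    the triangle inequality, |<T k_l, k_m>| is at most v^T E u, where E is the
    2 x 2 matrix of the numbers |<A k_(l1), k_(m1)>|, |<B k_(l2), k_(m1)>|,
    |<C k_(l1), k_(m2)>|, |<D k_(l2), k_(m2)>| ([normc_opmx2_le]).

    The adjoint needs no block formula: |<T^* k_l, k_m>| = |<T k_m, k_l>|, so the
    same estimate applies to it with l and m exchanged, which transposes the
    positions of B and C. In the combination with weights t and 1 - t, the
    diagonal coefficients are therefore bounded by the t-Berezin norms of A and
    D, and the off-diagonal ones by t |B|_ber + (1 - t) |C|_ber and
    t |C|_ber + (1 - t) |B|_ber. What remains is the value at (u, v) of the
    bilinear form of the matrix on the right, and u and v are unit vectors, so
    it is at most the operator norm ([bilinear_le_opnorm22]).

    Since the supremum of an unbounded set of reals is a default value, each of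
    the suprema used as an upper bound has to be shown to be over a bounded set:
    for the Berezin norms this is the Cauchy-Schwarz inequality together with
    the boundedness of continuous linear maps ([ber_coef_bounded]). *)

(** * The modulus of complex numbers *)

Lemma normcR (R : realType) (a : R) : 0 <= a -> Normc.normc a%:C = a.
Proof. by move=> a0; rewrite /Normc.normc /= expr0n /= addr0 sqrtr_sqr ger0_norm. Qed.

Lemma normc_conj (R : realType) (z : R[i]) : Normc.normc z^*%R = Normc.normc z.
Proof. by case: z => a b; rewrite /Normc.normc /= sqrrN. Qed.

Lemma le_normc (R : realType) (z : R[i]) (a : R) :
  (Normc.normc z <= a) = (`|z| <= a%:C).
Proof. by rewrite -lecR. Qed.

Lemma normc_ge0 (R : realType) (z : R[i]) : 0 <= Normc.normc z.
Proof. by case: z => a b; rewrite sqrtr_ge0. Qed.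

Lemma normc_triangle (R : realType) (z w : R[i]) :
  Normc.normc (z + w) <= Normc.normc z + Normc.normc w.
Proof. exact: le_normcD. Qed.

(** * The operator norm of scalar matrices *)

Section opnorm.
Variables (R : realType) (n : nat).
Implicit Types (M : 'M[R[i]]_n) (x : 'cV[R[i]]_n).

Lemma normc_le_l2norm x i : Normc.normc (x i 0) <= l2norm x.
Proof.
rewrite /l2norm -[leLHS]ger0_norm ?normc_ge0// -sqrtr_sqr ler_wsqrtr//.
by rewrite (bigD1 i)//= lerDl sumr_ge0// => j _; rewrite sqr_ge0.
Qed.

(** The right-hand side does not depend on [x]: the supremum defining
    [mx_opnorm M] is over a bounded set. *)
Lemma l2norm_mulmx_le M x : l2norm x <= 1 ->
  l2norm (M *m x) <= Num.sqrt (\sum_i (\sum_j Normc.normc (M i j)) ^+ 2).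
Proof.
move=> x1; apply: ler_wsqrtr; apply: ler_sum => i _.
rewrite ler_sqr ?nnegrE ?normc_ge0//; last by rewrite sumr_ge0// => j _; exact: normc_ge0.
rewrite le_normc mxE (le_trans (ler_norm_sum _ _ _))// rmorph_sum ler_sum// => j _.
rewrite -[leLHS]/((Normc.normc (M i j * x j 0))%:C) Normc.normcM lecR.
by rewrite ler_piMr ?normc_ge0// (le_trans (normc_le_l2norm x j)).
Qed.

Lemma l2norm_mulmx_opnorm M x : l2norm x <= 1 -> l2norm (M *m x) <= mx_opnorm M.
Proof.
move=> x1; apply: ub_le_sup; last by exists x.
by exists (Num.sqrt (\sum_i (\sum_j Normc.normc (M i j)) ^+ 2)) => _ [y y1 <-];
  exact: l2norm_mulmx_le.
Qed.

End opnorm.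

Lemma bilinear_le_opnorm22 (R : realType) (a b c d u1 u2 v1 v2 : R) :
  u1 ^+ 2 + u2 ^+ 2 = 1 -> v1 ^+ 2 + v2 ^+ 2 = 1 ->
  v1 * (a * u1 + b * u2) + v2 * (c * u1 + d * u2) <=
  mx_opnorm (mx22 a%:C b%:C c%:C d%:C).
Proof.
move=> u v.
have normcR2 (r : R) : Normc.normc r%:C ^+ 2 = r ^+ 2.
  by rewrite /Normc.normc /= expr0n /= addr0 sqr_sqrtr// sqr_ge0.
pose x : 'cV[R[i]]_2 := \col_i (if i == 0 then u1%:C else u2%:C).
have x1 : l2norm x <= 1.
  by rewrite /l2norm big_ord_recl big_ord1 !mxE /= !normcR2 u sqrtr1.
apply: le_trans (l2norm_mulmx_opnorm _ x1).
have -> : l2norm (mx22 a%:C b%:C c%:C d%:C *m x) =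
    Num.sqrt ((a * u1 + b * u2) ^+ 2 + (c * u1 + d * u2) ^+ 2).
  rewrite /l2norm big_ord_recl big_ord1 !mxE !big_ord_recl !big_ord0 !mxE /=.
  by rewrite !sqr_sqrtr ?addr_ge0 ?sqr_ge0//; congr (Num.sqrt _); ring.
move: (a * u1 + b * u2) (c * u1 + d * u2) => p q.
have [h|h] := leP (v1 * p + v2 * q) 0; first exact: le_trans h (sqrtr_ge0 _).
rewrite -[leLHS]ger0_norm ?(ltW h)// -sqrtr_sqr ler_wsqrtr//.
(* Cauchy-Schwarz in the plane, by Lagrange's identity. *)
rewrite -[leRHS]mul1r -v -subr_ge0.
by rewrite [leRHS](_ : _ = (v1 * q - v2 * p) ^+ 2) ?sqr_ge0//; ring.
Qed.

(** * Berezin norms on a reproducing kernel Hilbert space *)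

Section ber_coef.
Variables (R : realType) (Omega : Type) (H : rkhs R Omega).
Local Notation "''[' u , v ]" := (rk_dot H u v).
Local Notation nk := (rk_nker H).

Lemma rk_dotC (u v : H) : '[u, v] = ('[v, u])^*%R.
Proof. by rewrite hermC expr0 mul1r. Qed.

Lemma rk_dotZr a (u v : H) : '[u, a *: v] = a^*%R * '[u, v].
Proof. by rewrite rk_dotC linearZl_LR rmorphM /= -rk_dotC. Qed.

Lemma rk_dot_sub_scale (n c : R[i]) (x y : H) :
  '[n *: x - c *: y, n *: x - c *: y] =
  n * n^* * '[x, x] + c * c^* * '[y, y] - n * c^* * '[x, y] - c * n^* * '[y, x].
Proof.
rewrite linearBl /= !linearBr /= !linearZl_LR /= !rk_dotZr.
by rewrite /GRing.scale /=; ring.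
Qed.

Lemma rk_cauchy_schwarz (x y : H) : `|'[x, y]| <= `|x| * `|y|.
Proof.
have [->|y0] := eqVneq y 0; first by rewrite linear0r !normr0 mulr0.
rewrite -(@ler_pXn2r _ 2) ?nnegrE ?mulr_ge0// exprMn.
have y2 : 0 < '[y, y] by rewrite -rk_normE exprn_gt0// normr_gt0.
rewrite !rk_normE -(ler_pM2r y2) -subr_ge0.
(* This squared norm is <y, y> (<x, x> <y, y> - |<x, y>|^2). *)
have := exprn_ge0 2 (normr_ge0 ('[y, y] *: x - '[x, y] *: y)).
rewrite rk_normE rk_dot_sub_scale -(rk_dotC y x) -rk_dotC normCK.
by rewrite -rk_dotC; congr (0 <= _); ring.
Qed.

(** The modulus of <A k_l, k_m>, for the normalized kernels k_l and k_m. *)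
Definition ber_coef (A : H -> H) (l m : Omega) : R := Normc.normc '[A (nk l), nk m].

Lemma norm_rk_nker_le1 l : `|nk l| <= 1.
Proof.
rewrite /rk_nker normrZ normfV normr_id.
have [->|k0] := eqVneq (rk_ker H l) 0; first by rewrite normr0 mulr0.
by rewrite mulVf ?normr_eq0.
Qed.

Lemma ber_coef_bounded (A : {linear H -> H}) : continuous A ->
  exists M : R, forall l m, ber_coef A l m <= M.
Proof.
move=> Ac.
have /linear_boundedP/pinfty_ex_gt0[r r0 Ar] : bounded_near A (nbhs 0).
  exact/linear_bounded_continuous.
exists (complex.Re r) => l m.
(* A positive element of R[i] is real. *)
have rE : (complex.Re r)%:C = r by apply/eqP; move: r0; case: (r) => a b;
  rewrite ltcE eq_complex /= eqxx eq_sym => /andP[].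
rewrite le_normc rE (le_trans (rk_cauchy_schwarz _ _))//.
rewrite (le_trans (ler_pM _ _ (Ar _) (norm_rk_nker_le1 m)))// mulr1.
by rewrite ler_piMr ?(ltW r0)// norm_rk_nker_le1.
Qed.

Lemma ber_coef_le_ber (A : {linear H -> H}) l m : continuous A ->
  ber_coef A l m <= rk_ber A.
Proof.
move=> /ber_coef_bounded[M AM]; apply: ub_le_sup; last by exists (l, m).
by exists M => _ [p _ <-]; exact: AM.
Qed.

(** Passing to the adjoint exchanges the two points. *)
Lemma normc_adjoint (A : {linear H -> H}) l m : continuous A ->
  Normc.normc '[adjoint (rk_dot H) A (nk l), nk m] = ber_coef A m l.
Proof. by move=> Ac; rewrite rk_dotC -adjointP// normc_conj. Qed.

Lemma ber_coef_le_tber (t : R) (A : {linear H -> H}) l m :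
  0 <= t <= 1 -> continuous A ->
  t * ber_coef A l m + (1 - t) * ber_coef A m l <= rk_tber t A.
Proof.
move=> /andP[t0 t1] Ac; have [M AM] := ber_coef_bounded Ac.
apply: ub_le_sup; last by exists (l, m) => //=; rewrite normc_adjoint.
exists M => _ [p _ <-]; rewrite normc_adjoint//.
have := AM p.1 p.2; have := AM p.2 p.1; rewrite /ber_coef; nra.
Qed.

(** A normalized kernel of the direct sum is a combination of normalized kernels
    of [H] with weights N(l_i) / sqrt (N(l_1)^2 + N(l_2)^2), where N(l) is the norm
    of the kernel at l. *)
Lemma dsum_nkerE (p : Omega * Omega) : (forall l, rk_ker H l != 0) ->
  exists u1 u2 : R, [/\ 0 <= u1, 0 <= u2, u1 ^+ 2 + u2 ^+ 2 = 1 &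
    dsum_nker H p = (u1%:C *: nk p.1, u2%:C *: nk p.2)].
Proof.
move=> k0; pose N (l : Omega) : R := complex.Re `|rk_ker H l|.
have NE l : `|rk_ker H l| = (N l)%:C by rewrite RRe_real// ger0_real.
have N0 l : 0 < N l by rewrite -ltcR -NE normr_gt0.
have s0 : 0 < N p.1 ^+ 2 + N p.2 ^+ 2 by rewrite addr_gt0 ?exprn_gt0.
set s := _ + _ in s0; pose r := Num.sqrt s.
have r0 : 0 < r by rewrite sqrtr_gt0.
have sr : sqrtC (`|rk_ker H p.1| ^+ 2 + `|rk_ker H p.2| ^+ 2) = r%:C.
  apply/eqP; rewrite !NE -!rmorphXn -rmorphD /= -/s.
  rewrite -(@eqrXn2 _ 2)// ?sqrtC_ge0 ?ler0c ?(ltW s0) ?(ltW r0)//.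
  by rewrite sqrtCK -rmorphXn /= sqr_sqrtr// ltW.
exists (N p.1 / r), (N p.2 / r).
split; rewrite ?divr_ge0 ?(ltW r0) ?(ltW (N0 _))//.
  by rewrite !expr_div_n -mulrDl sqr_sqrtr ?(ltW s0)// divff// gt_eqF.
rewrite /dsum_nker sr /rk_nker !NE.
congr pair; rewrite scalerA -!fmorphV -rmorphM /=; congr (_%:C *: _).
all: by rewrite mulrAC divff ?mul1r// gt_eqF.
Qed.

Lemma normc_opmx2_le (A B C D : {linear H -> H}) l1 l2 m1 m2 (u1 u2 v1 v2 : R) :
  0 <= u1 -> 0 <= u2 -> 0 <= v1 -> 0 <= v2 ->
  Normc.normc (dsum_dot (opmx2 A B C D (u1%:C *: nk l1, u2%:C *: nk l2))
                        (v1%:C *: nk m1, v2%:C *: nk m2)) <=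
  v1 * (ber_coef A l1 m1 * u1 + ber_coef B l2 m1 * u2) +
  v2 * (ber_coef C l1 m2 * u1 + ber_coef D l2 m2 * u2).
Proof.
move=> u10 u20 v10 v20.
have bound (X Y : {linear H -> H}) m (v : R) : 0 <= v ->
    Normc.normc '[X (u1%:C *: nk l1) + Y (u2%:C *: nk l2), v%:C *: nk m] <=
    v * (ber_coef X l1 m * u1 + ber_coef Y l2 m * u2).
  (* The kernels are generalized: otherwise the scalar inside [nk] is pulled out
     with the weights. *)
  move=> v0; rewrite /ber_coef; move: (nk l1) (nk l2) (nk m) => x1 x2 y.
  rewrite rk_dotZr Normc.normcM normc_conj normcR// ler_wpM2l//.
  rewrite linearDl /= !linearZ /= !linearZl_LR.
  apply: le_trans (normc_triangle _ _) _.
  rewrite !Normc.normcM !normcR//.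
  by rewrite ![u1 * _]mulrC ![u2 * _]mulrC.
rewrite /dsum_dot /opmx2 /=.
apply: le_trans (normc_triangle _ _) _.
by rewrite lerD// bound.
Qed.

Lemma dsum_dotC (x y : H * H) : dsum_dot x y = (dsum_dot y x)^*%R.
Proof. by rewrite /dsum_dot rmorphD /= -!rk_dotC. Qed.

End ber_coef.

Theorem theorem2p11 (R : realType) (Omega : Type) (H : rkhs R Omega)
    (t : R) (A B C D : {linear H -> H}) :
  inhabited Omega ->
  (forall l : Omega, rk_ker H l != 0) ->
  0 <= t <= 1 ->
  continuous A -> continuous B -> continuous C -> continuous D ->
  dsum_tber t (opmx2 A B C D) <=
  mx_opnorm
    (mx22 (rk_tber t A)%:C
          (t * rk_ber B + (1 - t) * rk_ber C)%:C
          (t * rk_ber C + (1 - t) * rk_ber B)%:C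
          (rk_tber t D)%:C).
Proof.
move=> [w] k0 t01 Ac Bc Cc Dc; apply: ge_sup.
  by eexists; exists ((w, w), (w, w)).
move=> _ [[l m] _ <-] /=.
(* The term with the adjoint is the first term with [l] and [m] exchanged. *)
rewrite (dsum_dotC (adjoint _ _ _)) -dsum_adjointP// normc_conj.
have [u1 [u2 [u10 u20 u12 ->]]] := dsum_nkerE l k0.
have [v1 [v2 [v10 v20 v12 ->]]] := dsum_nkerE m k0.
apply: le_trans (bilinear_le_opnorm22 _ _ _ _ u12 v12).
have /andP[t0 t1] := t01; have t1' : 0 <= 1 - t by rewrite subr_ge0.
apply: le_trans.
  by apply: lerD; (apply: ler_wpM2l; [|exact: normc_opmx2_le]).
have := ber_coef_le_tber l.1 m.1 t01 Ac; have := ber_coef_le_tber l.2 m.2 t01 Dc.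
set a := rk_tber t A; set d := rk_tber t D => hD hA.
have hB : t * ber_coef B l.2 m.1 + (1 - t) * ber_coef C m.1 l.2 <=
    t * rk_ber B + (1 - t) * rk_ber C.
  by apply: lerD; apply: ler_wpM2l => //; exact: ber_coef_le_ber.
have hC : t * ber_coef C l.1 m.2 + (1 - t) * ber_coef B m.2 l.1 <=
    t * rk_ber C + (1 - t) * rk_ber B.
  by apply: lerD; apply: ler_wpM2l => //; exact: ber_coef_le_ber.
move: (t * rk_ber B + _) (t * rk_ber C + _) hB hC => b c hB hC.
rewrite [leLHS](_ : _ =
    v1 * ((t * ber_coef A l.1 m.1 + (1 - t) * ber_coef A m.1 l.1) * u1
        + (t * ber_coef B l.2 m.1 + (1 - t) * ber_coef C m.1 l.2) * u2)
  + v2 * ((t * ber_coef C l.1 m.2 + (1 - t) * ber_coef B m.2 l.1) * u1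
        + (t * ber_coef D l.2 m.2 + (1 - t) * ber_coef D m.2 l.2) * u2)); last by ring.
by rewrite lerD// ler_wpM2l// lerD// ler_wpM2r.
Qed.
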